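(* Let $G$ be a connected graph with $n$ vertices and $m$ edges, and let $T$ be a nonempty independent set of $G$ with $n_1$ vertices, $T\neq V(G)$. Then $$S_L(G)\ \ge\ \frac{n\sum_{v\in T}d(v)}{n_1(n-n_1)}-\delta(G).$$ If equality holds, then there exist $s$ and $t$ such that $d_{T^c}(v)=d(v)=s$ for all $v\in T$ and $d_T(v)=t$ for all $v\in T^c$, with $sn_1=t(n-n_1)$; moreover, $\mu_1(G)=\frac{n\sum_{v\in T}d(v)}{n_1(n-n_1)}$ and $a(G)=\delta(G)$.
   Context: Graphs are finite, simple and undirected. For a graph $G$ with $n$ vertices, $L(G)=D(G)-A(G)$ is the Laplacian matrix ($D(G)$ the diagonal matrix of vertex degrees, $A(G)$ the adjacency matrix), with eigenvalues $\mu_1\ge\dots\ge\mu_{n-1}\ge\mu_n=0$; $\mu_1(G)=\mu_1$. The algebraic connectivity is $a(G)=\mu_{n-1}$ and the Laplacian spread is $S_L(G)=\mu_1-a(G)$. $d(v)$ is the degree of $v$ and $\delta(G)$ is the minimum degree. For $Y\subseteq V(G)$, $Y^c=V(G)\setminus Y$ and $d_Y(v)$ is the number of neighbors of $v$ lying in $Y$. An independent set is a set of vertices no two of which are adjacent.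
   Formalization: The formal theorem additionally assumes that G is not complete: for K_n (n ≥ 2) every nonempty independent T is a single vertex, and then S_L = 0 while the claimed lower bound is n − (n−1) = 1, so the inequality is false there. *)

(* Defs.v *)
From HB Require Import structures.
From mathcomp Require Import all_boot all_order all_algebra.
From mathcomp Require Import polyrcf.
Set Implicit Arguments.
Unset Strict Implicit.
Unset Printing Implicit Defensive.
Import Order.TTheory GRing.Theory Num.Theory.
Local Open Scope ring_scope.

(* A finite simple graph is a finite type V of vertices with a symmetric and
   irreflexive adjacency relation e : rel V. *)
Section Graphs.
Variables (V : finType) (e : rel V).

Definition edge_set : {set {set V}} :=
  [set [set p.1; p.2] | p : V * V & e p.1 p.2].

Definition connected_graph : Prop := forall x y : V, connect e x y.

(* Complete graphs are singled out because a(K_n) = n > n - 1 = delta(K_n),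
   whereas a(G) <= delta(G) for every other graph. *)
Definition complete_graph : Prop := forall x y : V, x != y -> e x y.

Definition independent (T : {set V}) : Prop :=
  {in T &, forall x y, ~~ e x y}.

Definition deg_in (Y : {set V}) (v : V) : nat := #|[set w in Y | e v w]|.

Definition deg (v : V) : nat := #|[set w | e v w]|.

(* Degrees are smaller than #|V|, so the default value #|V| only matters when
   V is empty. *)
Definition min_deg : nat := \big[minn/#|V|]_(v : V) deg v.

Section Laplacian.
Variable R : rcfType.

Definition adj_mx : 'M[R]_#|V| :=
  \matrix_(i, j) (e (enum_val i) (enum_val j))%:R.

Definition deg_mx : 'M[R]_#|V| := diag_mx (\row_i (deg (enum_val i))%:R).

Definition laplacian : 'M[R]_#|V| := deg_mx - adj_mx.
End Laplacian.
End Graphs.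

(* All the eigenvalues of A that lie in R, repeated according to their
   multiplicity as roots of the characteristic polynomial, in non-increasing
   order; for a symmetric A this list has n elements. *)
Definition spectrum (R : rcfType) (n : nat) (A : 'M[R]_n) : seq R :=
  sort >=%R (flatten [seq nseq (mup x (char_poly A)) x
                     | x <- rootsR (char_poly A)]).

Section LaplacianSpectrum.
Variables (R : rcfType) (V : finType) (e : rel V).

(* lap_eig k is mu_k, with the indices k = 1, ..., #|V|. *)
Definition lap_eig (k : nat) : R := nth 0 (spectrum (laplacian e R)) k.-1.

Definition alg_connectivity : R := lap_eig #|V|.-1.

Definition lap_spread : R := lap_eig 1 - alg_connectivity.
End LaplacianSpectrum.

(* Main.v *)
Require Import Defs.
From mathcomp Require Import all_boot all_order all_algebra.
From mathcomp Require Import perm polyrcf complex.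
Set Implicit Arguments.
Unset Strict Implicit.
Unset Printing Implicit Defensive.
Import Order.TTheory GRing.Theory Num.Theory.
Local Open Scope complex_scope.
Local Open Scope ring_scope.
Local Open Scope sesquilinear_scope.

(** Both halves of the bound are Rayleigh quotient estimates for the
    Laplacian L.

    The vector equal to n - n1 on T and to -n1 off T has Rayleigh quotient
    q = n * (sum of the degrees in T) / (n1 * (n - n1)), since only the edges
    between T and its complement contribute to the quadratic form and, T being
    independent, they are exactly the edges that meet T.  Hence mu_1 >= q
    ([cut_le_lap_eig1]).

    A second vector, orthogonal to the constants, shows a(G) <= delta(G) for a
    graph that is not complete.  Let v have minimum degree and let W be the
    nonempty set of the vertices other than v and its neighbours.  Take |W| at
    v, -1 on W, and 0 on the neighbours of v.  As each vertex of W has at most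
    delta neighbours among those of v, the quotient is at most
    delta * (|W|^2 + |W|) / (|W|^2 + |W|) = delta ([alg_connectivity_le_deg]).

    In the equality case mu_1 = q and a(G) = delta(G), so the first vector
    attains the maximum of the Rayleigh quotient and is therefore an
    eigenvector of L for mu_1 ([rayleigh_le]).  Read at the vertices of T and
    of its complement, the eigenvector equation says that the number of
    neighbours on the other side is constant on each side
    ([cut_eq_lap_eig1]).

    The eigenvalues are defined as the sorted roots of the characteristic
    polynomial, so the Rayleigh principle ([rayleigh_le]) and the
    Courant-Fischer bound ([courant_fischer_le]) are derived from a spectral
    decomposition whose diagonal is that sorted list ([spectral_sorted]). *)

(** * Spectrum of a real symmetric matrix *)

Lemma spectrum_prod_XsubC (R : rcfType) n (A : 'M[R]_n) (s : seq R) :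
  char_poly A = \prod_(x <- s) ('X - x%:P) -> perm_eq (spectrum A) s.
Proof.
move=> As; rewrite /spectrum perm_sort As; apply/seq.permP => P.
have nz : \prod_(x <- s) ('X - x%:P) != 0 :> {poly R}.
  by rewrite monic_neq0 // monic_prod_XsubC.
have rE : rootsR (\prod_(x <- s) ('X - x%:P)) =i undup s.
  move=> x; rewrite mem_undup -[LHS]roots_on_rootsR // in_itv /=.
  exact: root_prod_XsubC.
have rP : perm_eq (rootsR (\prod_(x <- s) ('X - x%:P))) (undup s).
  by rewrite uniq_perm ?undup_uniq // uniq_roots.
rewrite count_flatten -map_comp (perm_sumn (perm_map _ rP)).
rewrite -(seq.permP (perm_count_undup s)) /= count_flatten -map_comp.
by congr sumn; apply: eq_map => x /=; rewrite mu_prod_XsubC.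
Qed.

Lemma map_prod_XsubC (R S : comNzRingType) (f : {rmorphism R -> S})
    (I : Type) (r : seq I) (F : I -> R) :
  map_poly f (\prod_(i <- r) ('X - (F i)%:P))
  = \prod_(i <- r) ('X - (f (F i))%:P).
Proof.
by rewrite rmorph_prod; apply: eq_bigr => i _; rewrite /= map_polyXsubC.
Qed.

Lemma char_poly_simmx (F : fieldType) n (P : 'M[F]_n) (B : 'M[F]_n) :
  P \in unitmx -> char_poly (invmx P *m B *m P) = char_poly B.
Proof.
move=> Pu; rewrite /char_poly /char_poly_mx !map_mxM.
have PK : map_mx polyC (invmx P) *m map_mx polyC P = 1%:M.
  by rewrite -map_mxM mulVmx // map_mx1.
have {1}-> : 'X%:M = map_mx polyC (invmx P) *m 'X%:M *m map_mx polyC P.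
  by rewrite mul_mx_scalar -scalemxAl PK scalemx1.
rewrite -mulmxBl -mulmxBr !det_mulmx mulrC mulrA -det_mulmx.
by rewrite (mulmx1C PK) det1 mul1r.
Qed.

(** The diagonalization is taken over the complex closure R[i], where normal
    matrices are unitarily diagonalizable; statements about real vectors are
    then recovered from it. *)
Section Symmetric.
Variables (R : rcfType) (n : nat) (A : 'M[R]_n).
Hypothesis A_sym : A^T = A.
Local Notation C := R[i].
Local Notation toC := (map_mx (real_complex R)).

Lemma conj_real_complex (x : R) : (x%:C)^* = x%:C :> C.
Proof. by rewrite conj_Creal // complex_real. Qed.

(** The characteristic polynomial of A factors over R because the diagonal of
    a unitary diagonalization of a Hermitian matrix is real.  The spectrum is
    thus a permutation of that diagonal, and permuting the rows of the unitary
    matrix accordingly sorts it. *)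
Lemma spectral_sorted :
  exists P : 'M[C]_n,
    [/\ size (spectrum A) = n, P \is unitarymx &
        toC A = P^t* *m diag_mx (\row_i (nth 0 (spectrum A) i)%:C) *m P].
Proof.
have Areal : toC A \is a realmx.
  by apply/mxOverP => i j; rewrite mxE complex_real.
have Aherm : toC A \is hermsymmx.
  apply: realsym_hermsym => //; apply/is_hermitianmxP.
  rewrite expr0 scale1r map_mx_id //.
  by rewrite -[in LHS]A_sym; apply/matrixP => i j; rewrite !mxE.
have /orthomx_spectralP AE := hermitian_normalmx Aherm.
have dR := hermitian_spectral_diag_real Aherm.
have Pu := spectral_unitarymx (toC A).
move: AE dR Pu; set P := spectralmx _; set dC := spectral_diag _ => AE dR Pu.
pose d i := complex.Re (dC 0 i).
have dE i : dC 0 i = (d i)%:C.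
  by rewrite /d RRe_real //; move/mxOverP: dR; apply.
have chA : char_poly A = \prod_(x <- [tuple d i | i < n]) ('X - x%:P).
  apply: (map_poly_inj (real_complex R)).
  rewrite map_char_poly AE char_poly_simmx ?unitarymx_unit //.
  rewrite char_poly_trig ?diag_mx_is_trig // big_map map_prod_XsubC.
  rewrite big_enum /=; apply: eq_bigr => i _.
  by rewrite mxE eqxx mulr1n dE.
have {}sp := spectrum_prod_XsubC chA.
have /tuple_permP [p pE] : perm_eq (spectrum A) [tuple d i | i < n] by [].
have nE i : nth 0 (spectrum A) (nat_of_ord i) = d (p i).
  by rewrite pE -tnth_nth !tnth_mktuple.
exists (row_perm p P); split; first by rewrite pE size_tuple.
  apply/unitarymxP/matrixP => i j; move/unitarymxP/matrixP: Pu.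
  move/(_ (p i) (p j)); rewrite !mxE (inj_eq perm_inj) => <-.
  by apply: eq_bigr => k _; rewrite !mxE.
rewrite AE invmx_unitary //; apply/matrixP => i j.
rewrite !mxE (reindex_inj (@perm_inj _ p)) /=; apply: eq_bigr => k _.
rewrite !mul_mx_diag !mxE nE dE //.
Qed.

Lemma spectrum_antimono i j :
  (i <= j < size (spectrum A))%N ->
  nth 0 (spectrum A) j <= nth 0 (spectrum A) i.
Proof.
move=> /andP[ij jn]; apply: (sorted_leq_nth ge_trans) => //=.
- exact: lexx.
- by apply: sort_sorted => x y; exact: le_total.
- by rewrite inE (leq_ltn_trans ij).
Qed.

Definition qform (B : 'M[R]_n) (x : 'rV[R]_n) : R := (x *m B *m x^T) 0 0.

(** A symmetric real form takes the value B(x) + B(y) at x + i y in its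
    Hermitian extension: the cross terms cancel.  A Rayleigh bound valid on a
    real subspace is therefore valid on its complexification. *)
Lemma qform_complex (B : 'M[R]_n) (z : 'rV[C]_n) : B^T = B ->
  (z *m toC B *m z^t*) 0 0 =
  (qform B (map_mx (@complex.Re R) z) + qform B (map_mx (@complex.Im R) z))%:C.
Proof.
move=> B_sym; set x := map_mx (@complex.Re R) z; set y := map_mx _ z.
have zE : z = toC x + 'i%C *: toC y.
  by apply/rowP => i; rewrite !mxE [LHS]complexE.
have zEt : z^t* = toC x^T - 'i%C *: toC y^T.
  rewrite zE; apply/colP => i; rewrite !mxE rmorphD rmorphM /= !conj_real_complex.
  rewrite (_ : 'i%C^* = - 'i%C) ?mulNr //.
  by apply/eqP; rewrite eq_complex /= oppr0 !eqxx.
have xy : y *m B *m x^T = x *m B *m y^T.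
  have -> : y *m B *m x^T = (x *m B *m y^T)^T.
    by rewrite !trmx_mul trmxK B_sym mulmxA.
  by apply/matrixP => i j; rewrite !ord1 mxE.
rewrite zEt [in LHS]zE !mulmxDl !mulmxBr -!scalemxAl -!scalemxAr -!map_mxM xy.
rewrite scalerA -expr2 sqr_i scaleN1r opprK /qform.
by rewrite addrA subrK mxE [X in X + _]mxE [X in _ + X]mxE rmorphD.
Qed.

Lemma qform_real (B : 'M[R]_n) (x : 'rV[R]_n) :
  (toC x *m toC B *m (toC x)^t*) 0 0 = (qform B x)%:C.
Proof.
have -> : (toC x)^t* = toC x^T.
  by apply/matrixP => i j; rewrite !mxE conj_real_complex.
by rewrite -!map_mxM mxE.
Qed.

(** The squared modulus of the i-th coordinate of z in the orthonormal basis
    formed by the rows of P. *)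
Definition weight (P : 'M[C]_n) (z : 'rV[C]_n) i : R :=
  complex.Re `|(z *m P^t*) 0 i| ^+ 2.

Lemma weightE P z i : (weight P z i)%:C = `|(z *m P^t*) 0 i| ^+ 2.
Proof. by rewrite /weight rmorphXn -[in RHS](RRe_real (normr_real _)). Qed.

Lemma weight_ge0 P z i : 0 <= weight P z i.
Proof. exact: sqr_ge0. Qed.

Lemma weight_eq0 P z i : (weight P z i == 0) = ((z *m P^t*) 0 i == 0).
Proof. by rewrite -(inj_eq (@complexI R)) weightE expf_eq0 /= normr_eq0. Qed.

Lemma qform_weights (B : 'M[R]_n) (P : 'M[C]_n) (d : 'I_n -> R) (z : 'rV[C]_n) :
    toC B = P^t* *m diag_mx (\row_i (d i)%:C) *m P ->
  (z *m toC B *m z^t*) 0 0 = (\sum_i d i * weight P z i)%:C.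
Proof.
move=> ->; pose c := z *m P^t*.
have -> : z *m (P^t* *m diag_mx (\row_i (d i)%:C) *m P) *m z^t* =
          c *m diag_mx (\row_i (d i)%:C) *m c^t*.
  by rewrite /c trmx_mul map_mxM trmxCK !mulmxA.
rewrite mul_mx_diag mxE rmorph_sum; apply: eq_bigr => i _.
by rewrite rmorphM /= weightE normCK !mxE mulrCA -mulrA mulrC -mulrA.
Qed.

(** The identity is decomposed along the same basis, so that
    [qform_weights] also computes squared norms. *)
Lemma unitary_decomp1 (P : 'M[C]_n) : P \is unitarymx ->
  toC 1%:M = P^t* *m diag_mx (\row_i (1 : R)%:C) *m P.
Proof.
move=> Pu; rewrite map_mx1 -invmx_unitary //.
have -> : diag_mx (\row_(i < n) (1 : R)%:C) = 1%:M.
  by apply/matrixP => i j; rewrite !mxE.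
by rewrite mulmx1 mulVmx // unitarymx_unit.
Qed.

(** Both sides are sums over the eigenbasis of A, with coefficients mu_i and
    mu_1 >= mu_i on the same weights.  Equality forces the weight to vanish
    wherever mu_i differs from mu_1, that is, x lies in the eigenspace. *)
Lemma rayleigh_le (x : 'rV[R]_n) :
  qform A x <= nth 0 (spectrum A) 0 * qform 1%:M x
  ?= iff (x *m A == nth 0 (spectrum A) 0 *: x).
Proof.
have [P [szA Pu AE]] := spectral_sorted.
set mu := nth 0 (spectrum A) in AE *.
have qA : qform A x = \sum_(i < n) mu i * weight P (toC x) i.
  by apply: (@complexI R); rewrite -qform_real (qform_weights _ AE).
have q1 : qform 1%:M x = \sum_(i < n) 1 * weight P (toC x) i.
  apply: (@complexI R).
  by rewrite -qform_real (qform_weights _ (unitary_decomp1 Pu)).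
have le_mu (i : 'I_n) : mu i <= mu 0%N by rewrite spectrum_antimono //= szA.
have le_i (i : 'I_n) :
    mu i * weight P (toC x) i <= mu 0%N * (1 * weight P (toC x) i)
    ?= iff (mu i * weight P (toC x) i == mu 0%N * (1 * weight P (toC x) i)).
  by split=> //; rewrite mul1r ler_wpM2r ?weight_ge0.
rewrite qA q1 mulr_sumr; apply/leifP; case: ifPn => [/eqP xA|].
  by apply/eqP; rewrite -mulr_sumr -qA -q1 /qform xA mulmx1 -scalemxAl [LHS]mxE.
rewrite lt_neqAle => nx; apply/andP; split.
  2: by apply: ler_sum => i _; apply: le_i.
apply: contraNneq nx => /eqP.
rewrite (leif_sum (fun i _ => le_i i)) => /forallP eqi.
pose c := toC x *m P^t*.
have PK : P^t* *m P = 1%:M.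
  by rewrite -invmx_unitary // mulVmx // unitarymx_unit.
have cK : c *m P = toC x by rewrite -mulmxA PK mulmx1.
have inj : injective (fun y : 'rV[R]_n => toC y).
  move=> y y' /rowP yy; apply/rowP => j.
  by have := yy j; rewrite !mxE => /complexI.
rewrite -(inj_eq inj) map_mxM map_mxZ AE !mulmxA -/c.
apply/eqP; rewrite -cK scalemxAl; congr (_ *m P).
apply/rowP => i; rewrite mul_mx_diag [LHS]mxE [RHS]mxE mulrC.
rewrite [(\row__ _) 0 i]mxE.
have := eqi i; rewrite /= mul1r -subr_eq0 -mulrBl mulf_eq0 weight_eq0 subr_eq0.
by case/orP => /eqP; [move->|rewrite -/c => ->; rewrite !mulr0].
Qed.

(** The (k+1)-dimensional space U meets the span of the eigenvectors of the
    n - k largest eigenvalues, by a count of dimensions.  At a common nonzero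
    vector the Rayleigh quotient is at least the smallest of these eigenvalues,
    whose 0-based index is n - k - 1, and at most rho.  The intersection is
    taken over R[i], since the eigenbasis is complex. *)
Lemma courant_fischer_le k (U : 'M[R]_(k.+1, n)) rho : row_free U ->
    (forall x : 'rV_n, (x <= U)%MS -> qform A x <= rho * qform 1%:M x) ->
  nth 0 (spectrum A) (n - k.+1) <= rho.
Proof.
move=> Ufree UA; have [P [szA Pu AE]] := spectral_sorted.
have kn : (k < n)%N by rewrite -(eqP Ufree) rank_leq_col.
have fP (b : 'I_k) : (n - k + b < n)%N.
  by rewrite -ltn_subRL subKn // ltnW.
pose K := toC U *m P^t*.
(* v *m M lists the last k coordinates, in the eigenbasis, of v *m toC U. *)
pose M : 'M[C]_(k.+1, k) := \matrix_(a, b) K a (Ordinal (fP b)).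
have kerM : kermx M != 0.
  rewrite -mxrank_eq0 mxrank_ker -lt0n subn_gt0 ltnS; exact: rank_leq_col.
pose v := nz_row (kermx M); have v0 : v != 0 by rewrite nz_row_eq0.
have vM : v *m M = 0 by apply/sub_kermxP; exact: nz_row_sub.
pose z := v *m toC U.
have z0 : z != 0 by rewrite mulmx_free_eq0 // /row_free mxrank_map.
have vanish (i : 'I_n) : (n - k <= i)%N -> weight P z i = 0.
  move=> ki; apply/eqP; rewrite weight_eq0.
  have ik : (i - (n - k) < k)%N.
    by rewrite ltn_subLR // subnK ?ltn_ord // ltnW.
  suff -> : (z *m P^t*) 0 i = (v *m M) 0 (Ordinal ik) by rewrite vM mxE.
  rewrite -mulmxA [LHS]mxE [RHS]mxE; apply: eq_bigr => a _.
  by rewrite [M _ _]mxE; congr (_ * K _ _); apply/val_inj; rewrite /= subnKC.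
set mu := nth 0 (spectrum A) in AE *.
have W0 : 0 < \sum_(i < n) weight P z i.
  rewrite lt_neqAle sumr_ge0 ?andbT => [|i _]; last exact: weight_ge0.
  apply: contraNneq z0 => /esym/eqP.
  rewrite psumr_eq0 => [/allP w0|i _]; last exact: weight_ge0.
  rewrite -[z]mulmx1 -(mulVmx (unitarymx_unit Pu)) invmx_unitary // mulmxA.
  rewrite (_ : z *m P^t* = 0) ?mul0mx //; apply/rowP => i; rewrite [RHS]mxE.
  apply/eqP; rewrite -weight_eq0.
  exact: (implyP (w0 i (mem_index_enum i))).
rewrite -(ler_pM2r W0).
apply: (@le_trans _ _ (\sum_(i < n) mu i * weight P z i)).
  rewrite mulr_sumr; apply: ler_sum => i _.
  have [ki|ki] := leqP (n - k) i; first by rewrite vanish // !mulr0.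
  rewrite ler_wpM2r ?weight_ge0 // spectrum_antimono // szA.
  by rewrite -ltnS -subSn // subSS ki leq_subr.
rewrite -lecR rmorphM /= -(qform_weights _ AE) qform_complex //.
have -> : \sum_(i < n) weight P z i = \sum_(i < n) 1 * weight P z i.
  by apply: eq_bigr => i _; rewrite mul1r.
rewrite -(qform_weights _ (unitary_decomp1 Pu)) qform_complex ?trmx1 //.
rewrite -rmorphM lecR mulrDr.
have Re_sub : (map_mx (@complex.Re R) z <= U)%MS.
  apply/submxP; exists (map_mx (@complex.Re R) v); apply/rowP => j.
  rewrite !mxE raddf_sum; apply: eq_bigr => a _; rewrite !mxE.
  by case: (v 0 a) => p q /=; rewrite mulr0 subr0.
have Im_sub : (map_mx (@complex.Im R) z <= U)%MS.
  apply/submxP; exists (map_mx (@complex.Im R) v); apply/rowP => j.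
  rewrite !mxE raddf_sum; apply: eq_bigr => a _; rewrite !mxE.
  by case: (v 0 a) => p q /=; rewrite mulr0 add0r.
by apply: lerD; apply: UA.
Qed.

End Symmetric.

(** * The Laplacian quadratic form *)

Section LaplacianForm.
Variables (R : rcfType) (V : finType) (e : rel V).
Hypothesis e_sym : symmetric e.

Definition vec (f : V -> R) : 'rV[R]_#|V| := \row_i f (enum_val i).

Definition lap (f : V -> R) (v : V) : R := \sum_w (e v w)%:R * (f v - f w).

Lemma sum_enum_val (F : V -> R) : \sum_(i < #|V|) F (enum_val i) = \sum_v F v.
Proof. by rewrite -(big_enum_val F); apply: eq_bigl. Qed.

Lemma vecP (f g : V -> R) : vec f = vec g -> f =1 g.
Proof.
by move=> /rowP fg v; have := fg (enum_rank v); rewrite !mxE enum_rankK.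
Qed.

Lemma vecZ a f : vec (fun v => a * f v) = a *: vec f.
Proof. by apply/rowP => i; rewrite !mxE. Qed.

Lemma deg_in_sum (Y : {set V}) v :
  (deg_in e Y v)%:R = \sum_(w in Y) (e v w)%:R :> R.
Proof.
rewrite -natr_sum /deg_in -sum1_card; congr _%:R.
rewrite [RHS](bigID (e v)) /= [X in (_ + X)%N]big1 ?addn0.
  by apply: eq_big => [w|w]; rewrite inE // => /andP[_ ->].
by move=> w /andP[_ /negPf->].
Qed.

Lemma deg_sum v : (deg e v)%:R = \sum_w (e v w)%:R :> R.
Proof.
have -> : deg e v = deg_in e setT v by apply: eq_card => w; rewrite !inE.
by rewrite deg_in_sum; apply: eq_bigl => w; rewrite inE.
Qed.

Lemma laplacian_sym : (laplacian e R)^T = laplacian e R.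
Proof.
rewrite /laplacian linearB /= tr_diag_mx; congr (_ - _).
by apply/matrixP => i j; rewrite !mxE e_sym.
Qed.

Lemma vec_laplacian f : vec f *m laplacian e R = vec (lap f).
Proof.
apply/rowP => i; rewrite /laplacian mulmxBr mul_mx_diag !mxE /lap.
under [X in _ = X]eq_bigr => w _ do rewrite mulrBr.
rewrite sumrB -mulr_suml deg_sum mulrC; congr (_ - _).
rewrite -sum_enum_val; apply: eq_bigr => j _.
by rewrite !mxE e_sym mulrC.
Qed.

Lemma qform_laplacian f :
  qform (laplacian e R) (vec f) = \sum_v f v * lap f v.
Proof.
rewrite /qform vec_laplacian mxE -sum_enum_val; apply: eq_bigr => i _.
by rewrite !mxE mulrC.
Qed.

Lemma qform1 f : qform 1%:M (vec f) = \sum_v f v ^+ 2.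
Proof.
rewrite /qform mulmx1 mxE -sum_enum_val; apply: eq_bigr => i _.
by rewrite !mxE.
Qed.

(** Each edge contributes opposite amounts at its two ends. *)
Lemma sum_lap f : \sum_v lap f v = 0.
Proof.
rewrite /lap; under eq_bigr => v _.
  under eq_bigr => w _ do rewrite mulrBr.
  rewrite sumrB; over.
rewrite sumrB [X in _ - X]exchange_big /= -sumrB big1 // => v _.
by rewrite -sumrB big1 // => w _; rewrite e_sym subrr.
Qed.

(** Courant-Fischer for the plane spanned by the constants and f.  Since L
    kills the constants and f is orthogonal to them, adding a constant to f
    leaves the quadratic form unchanged and only increases the norm; as rho is
    nonnegative, the bound at f extends to the whole plane. *)
Lemma alg_connectivity_le f rho : 0 <= rho -> \sum_v f v = 0 ->
    (exists v, f v != 0) ->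
    \sum_v f v * lap f v <= rho * \sum_v f v ^+ 2 ->
  alg_connectivity R e <= rho.
Proof.
move=> rho0 f_sum [v0 fv0] f_le.
pose U : 'M[R]_(2, #|V|) :=
  \matrix_(i < 2) (if i == 0 then vec (fun=> 1) else vec f).
have UE (w : 'rV_2) : w *m U = vec (fun v => w 0 0 + w 0 1 * f v).
  apply/rowP => j; rewrite !mxE !big_ord_recl big_ord0 !mxE /= mulr1 addr0.
  by congr (_ + w _ _ * _); apply/val_inj.
rewrite /alg_connectivity /lap_eig -!subn1 -subnDA.
apply: (courant_fischer_le laplacian_sym (U := U)).
  rewrite -kermx_eq0; apply/rowV0P => w /sub_kermxP.
  rewrite UE => w0.
  have wE v : w 0 0 + w 0 1 * f v = 0.
    have -> : 0 = (fun=> 0) v :> R by [].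
    by move: v; apply: vecP; rewrite w0; apply/rowP => i; rewrite !mxE.
  have : \sum_v (w 0 0 + w 0 1 * f v) = 0 by apply: big1 => v _; exact: wE.
  rewrite big_split /= -mulr_sumr f_sum mulr0 addr0 sumr_const -mulr_natr.
  move/eqP; rewrite mulf_eq0 pnatr_eq0 => /orP[/eqP w00|/eqP/card0_eq/(_ v0)] //.
  have /eqP := wE v0; rewrite w00 add0r mulf_eq0 (negPf fv0) orbF => /eqP w01.
  apply/rowP => i; rewrite mxE; case: (unliftP 0 i) => [j|] -> //.
  by rewrite ord1 -w01; congr (w _ _); apply/val_inj.
move=> x /submxP[w ->]; rewrite UE qform_laplacian qform1.
set a := w 0 0; set b := w 0 1.
have lE v : lap (fun v => a + b * f v) v = b * lap f v.
  rewrite /lap mulr_sumr; apply: eq_bigr => u _.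
  by rewrite opprD addrACA subrr add0r -mulrBr mulrCA.
have -> : \sum_v (a + b * f v) * lap (fun v => a + b * f v) v =
          b ^+ 2 * \sum_v f v * lap f v.
  under eq_bigr => v _ do rewrite lE mulrDl.
  rewrite big_split /= -!mulr_sumr sum_lap !mulr0 add0r mulr_sumr.
  by apply: eq_bigr => v _; rewrite expr2 -!mulrA (mulrCA (f v)).
have -> : \sum_v (a + b * f v) ^+ 2 =
          a ^+ 2 *+ #|V| + b ^+ 2 * \sum_v f v ^+ 2.
  under eq_bigr => v _ do rewrite sqrrD exprMn mulrA -mulrnAl.
  by rewrite !big_split /= sumr_const -!mulr_sumr f_sum mulr0 addr0.
rewrite mulrDr mulrCA -[leLHS]add0r; apply: lerD.
  by rewrite mulr_ge0 // mulrn_wge0 // sqr_ge0.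
by apply: ler_wpM2l => //; exact: sqr_ge0.
Qed.

End LaplacianForm.

(** * The largest eigenvalue and cuts *)

Section Cut.
Variables (R : rcfType) (V : finType) (e : rel V).
Hypothesis e_sym : symmetric e.
Variable T : {set V}.
Local Notation N := (#|V|%:R : R).
Local Notation a := (#|T|%:R : R).
Local Notation mu1 := (lap_eig R e 1).

(** The projection orthogonal to the constants of the indicator of T, scaled
    by n. *)
Definition cut_vector (v : V) : R := if v \in T then N - a else - a.

(** Both sums count the edges of the cut. *)
Lemma sum_deg_in_cut :
  \sum_(v in ~: T) (deg_in e T v)%:R = \sum_(v in T) (deg_in e (~: T) v)%:R :> R.
Proof.
under eq_bigr => v _ do rewrite deg_in_sum.
under [RHS]eq_bigr => v _ do rewrite deg_in_sum.
rewrite exchange_big /=; apply: eq_bigr => v _; apply: eq_bigr => w _.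
by rewrite e_sym.
Qed.

Lemma lap_cut_vector v : lap e cut_vector v =
  if v \in T then N * (deg_in e (~: T) v)%:R else - (N * (deg_in e T v)%:R).
Proof.
rewrite /lap !deg_in_sum !mulr_sumr -sumrN (bigID (mem T)) /=.
rewrite /cut_vector; case: ifP => vT.
  rewrite big1 ?add0r => [|w ->]; last by rewrite subrr mulr0.
  apply: eq_big => [w|w /negPf ->]; first by rewrite inE.
  by rewrite opprK subrK mulrC.
rewrite addrC big1 ?add0r => [|w /negPf ->]; last by rewrite subrr mulr0.
by apply: eq_bigr => w ->; rewrite opprB addKr mulrN mulrC.
Qed.

Lemma sum_over_cut (x y : V -> R) :
  \sum_v (if v \in T then x v else y v) =
  \sum_(v in T) x v + \sum_(v in ~: T) y v.
Proof.
rewrite (bigID (mem T)) /=; congr (_ + _); first by apply: eq_bigr => v ->.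
by apply: eq_big => [v|v /negPf ->]; rewrite ?inE.
Qed.

Lemma card_cutC : #|~: T|%:R = N - a.
Proof. by rewrite -(cardsC T) natrD addrAC subrr add0r. Qed.

Lemma qform_cut_vector : qform (laplacian e R) (vec cut_vector) =
  N ^+ 2 * \sum_(v in T) (deg_in e (~: T) v)%:R.
Proof.
rewrite qform_laplacian //.
have E v : cut_vector v * lap e cut_vector v =
    if v \in T then (N - a) * N * (deg_in e (~: T) v)%:R
    else a * N * (deg_in e T v)%:R.
  by rewrite lap_cut_vector /cut_vector; case: ifP => _; rewrite ?mulrNN mulrA.
under eq_bigr => v _ do rewrite E.
by rewrite sum_over_cut -!mulr_sumr sum_deg_in_cut -!mulrDl subrK.
Qed.

Lemma qform1_cut_vector : qform 1%:M (vec cut_vector) = N * (a * (N - a)).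
Proof.
rewrite qform1.
have E v : cut_vector v ^+ 2 = if v \in T then (N - a) ^+ 2 else a ^+ 2.
  by rewrite /cut_vector; case: ifP => // _; rewrite sqrrN.
under eq_bigr => v _ do rewrite E.
rewrite sum_over_cut sumr_const -[X in X + _]mulr_natl.
have -> : \sum_(v in ~: T) a ^+ 2 = (N - a) * a ^+ 2.
  by rewrite sumr_const -[LHS]mulr_natl; congr (_ * _); exact: card_cutC.
have E3 (x y : R) : x * (y - x) ^+ 2 + (y - x) * x ^+ 2 = y * (x * (y - x)).
  by rewrite !expr2 [x * (_ * _)]mulrCA -!mulrDr subrK mulrC -mulrA mulrCA.
exact: E3.
Qed.

Hypotheses (T_neq0 : T != set0) (T_neqV : T != setT).

Lemma cut_gt0 : [/\ 0 < a, 0 < N - a & 0 < N].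
Proof.
have a0 : 0 < a by rewrite ltr0n card_gt0.
have b0 : 0 < N - a.
  rewrite -card_cutC ltr0n card_gt0.
  by apply: contraNneq T_neqV => TC0; rewrite -[T]setCK TC0 setC0.
by split=> //; rewrite -(subrK a N) addr_gt0.
Qed.

(** The left-hand side is the Rayleigh quotient of [cut_vector]. *)
Lemma cut_le_lap_eig1 :
  N * (\sum_(v in T) (deg_in e (~: T) v)%:R) / (a * (N - a)) <= mu1.
Proof.
have [a0 b0 N0] := cut_gt0.
rewrite ler_pdivrMr ?mulr_gt0 // -(ler_pM2l N0) mulrA -expr2.
rewrite -qform_cut_vector mulrCA -qform1_cut_vector.
exact: rayleigh_le (laplacian_sym R e_sym) _.
Qed.

(** Equality makes [cut_vector] an eigenvector for mu_1; the conclusions are,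
    up to sign, the coordinates of the eigenvector equation. *)
Lemma cut_eq_lap_eig1 :
    mu1 = N * (\sum_(v in T) (deg_in e (~: T) v)%:R) / (a * (N - a)) ->
  (forall v, v \in T -> N * (deg_in e (~: T) v)%:R = mu1 * (N - a)) /\
  (forall v, v \in ~: T -> N * (deg_in e T v)%:R = mu1 * a).
Proof.
have [a0 b0 N0] := cut_gt0.
move=> mu1E.
have eigen : lap e cut_vector =1 (fun v => mu1 * cut_vector v).
  apply: vecP; rewrite vecZ -(vec_laplacian e_sym).
  apply/eqP; rewrite -(rayleigh_le (laplacian_sym R e_sym) (vec cut_vector)).2.
  rewrite -/(lap_eig R e 1) qform_cut_vector qform1_cut_vector mu1E.
  by rewrite mulrCA mulfVK ?mulrA ?expr2 // mulf_neq0 ?gt_eqF.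
split=> v; last rewrite inE; have := eigen v.
  by rewrite lap_cut_vector /cut_vector => + vT; rewrite vT.
rewrite lap_cut_vector /cut_vector => + /negPf vT; rewrite vT.
by rewrite mulrN => /oppr_inj.
Qed.

End Cut.

(** * Algebraic connectivity and minimum degree *)

Section MinDegree.
Variables (R : rcfType) (V : finType) (e : rel V).
Hypotheses (e_sym : symmetric e) (e_irr : irreflexive e).

Lemma min_deg_attained (x : V) :
  exists2 v, deg e v = min_deg e & forall w, (min_deg e <= deg e w)%N.
Proof.
have min_le w : (min_deg e <= deg e w)%N.
  rewrite /min_deg; elim: (index_enum V) (mem_index_enum w) => // u s IHs.
  rewrite inE big_cons => /predU1P[->|/IHs]; first exact: geq_minl.
  by apply: leq_trans; exact: geq_minr.
case: (arg_minnP (deg e) (erefl (xpredT x))) => v _ v_min.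
exists v => //; apply/eqP; rewrite eqn_leq min_le andbT /min_deg.
elim/big_ind: _ => [|p q vp vq|w _]; last exact: v_min.
  (* The default value #|V| of the minimum is at least every degree. *)
  exact: max_card.
by rewrite leq_min vp.
Qed.

Definition far (v : V) : {set V} := [set w | (w != v) && ~~ e v w].

(** If a vertex of minimum degree is adjacent to all the others, then every
    vertex has degree n - 1. *)
Lemma far_neq0 v : ~ complete_graph e -> (forall w, deg e v <= deg e w)%N ->
  far v != set0.
Proof.
move=> nc v_min; apply/negP => /eqP far0; apply: nc => x y xy.
have sub w : [set u | e w u] \subset ~: [set w].
  by apply/subsetP => u; rewrite !inE; apply: contraTneq => ->; rewrite e_irr.
have v_full : [set w | e v w] = ~: [set v].
  apply/eqP; rewrite eqEsubset sub; apply/subsetP => w; rewrite !inE => wv.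
  by have := in_set0 w; rewrite -far0 inE wv => /negbFE.
have: y \in ~: [set x] by rewrite !inE eq_sym.
have /eqP <- : [set u | e x u] == ~: [set x]; last by rewrite inE.
rewrite eqEcard sub; have := v_min x; rewrite /deg v_full.
by rewrite !cardsC1.
Qed.

(** The test vector is |W| at v, -1 on W := far v and 0 elsewhere.  Its image
    under L is deg v * |W| at v, and at u in W it is minus the number of neighbours of
    u outside W, all of which are neighbours of v. *)
Lemma alg_connectivity_le_deg v : far v != set0 ->
  alg_connectivity R e <= (deg e v)%:R.
Proof.
move=> W0; set W := far v; pose b : R := #|W|%:R.
have vW : v \notin W by rewrite inE eqxx.
pose f u : R := if u == v then b else if u \in W then -1 else 0.
have b0 : 0 < b by rewrite ltr0n card_gt0.
have fv : f v = b by rewrite /f eqxx.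
have sumE (F G : V -> R) :
    (forall u, u != v -> F u = if u \in W then G u else 0) ->
    \sum_u F u = F v + \sum_(u in W) G u.
  move=> FG; rewrite (bigD1 v) //=; congr (_ + _).
  rewrite (eq_bigr _ FG) -big_mkcondr; apply: eq_bigl => u.
  by case: eqVneq => // ->; rewrite (negPf vW).
apply: (@alg_connectivity_le _ _ _ e_sym f); first exact: ler0n.
- rewrite (sumE _ (fun=> -1)) => [|u /negPf uv]; last by rewrite /f uv.
  by rewrite fv sumr_const mulNrn subrr.
- by exists v; rewrite fv gt_eqF.
rewrite (sumE (fun u => f u ^+ 2) (fun=> 1)) => [|u /negPf uv]; last first.
  by rewrite /f uv; case: ifP => _; rewrite ?expr0n // sqrrN expr1n.
rewrite (sumE _ (fun u => - lap e f u)) => [|u /negPf uv]; last first.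
  by rewrite {1}/f uv; case: ifP => _; rewrite ?mul0r // mulN1r.
have lap_v : lap e f v = (deg e v)%:R * b.
  rewrite /lap deg_sum mulr_suml; apply: eq_bigr => u _; rewrite fv /f inE.
  case: (eqVneq u v) => [->|_]; first by rewrite e_irr !mul0r.
  by case: (e v u); rewrite ?mul0r //= subr0.
have lap_W u : u \in W -> - lap e f u <= (deg e v)%:R.
  move=> uW; have := uW; rewrite inE => /andP[/negPf uv nuv].
  rewrite /lap deg_sum -sumrN; apply: ler_sum => w _.
  rewrite {1}/f uv uW /f.
  case: (eqVneq w v) => [->|wv].
    by rewrite e_sym (negPf nuv) mul0r oppr0 ler0n.
  rewrite inE wv /=; case: (e v w) => /=.
    by rewrite subr0 mulrN1 opprK ler_nat leq_b1.
  by rewrite subrr mulr0 oppr0.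
rewrite fv lap_v mulrDr; apply: lerD; first by rewrite expr2 mulrCA.
rewrite mulr_sumr; apply: ler_sum => u uW; rewrite mulr1; exact: lap_W.
Qed.

Lemma alg_connectivity_le_min_deg (x : V) :
  ~ complete_graph e -> alg_connectivity R e <= (min_deg e)%:R.
Proof.
move=> nc; have [v <- v_min] := min_deg_attained x.
by apply/alg_connectivity_le_deg/far_neq0.
Qed.

End MinDegree.

(** * The Laplacian spread *)

Theorem corollary7 (R : rcfType) (V : finType) (e : rel V)
    (e_sym : symmetric e) (e_irr : irreflexive e)
    (e_conn : connected_graph e) (e_ncomplete : ~ complete_graph e)
    (n m : nat) (Vn : #|V| = n) (Em : #|edge_set e| = m)
    (T : {set V}) (n1 : nat) (Tn1 : #|T| = n1)
    (T_indep : independent e T) (T_neq0 : T != set0) (T_neqV : T != setT) :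
  let q : R :=
    n%:R * (\sum_(v in T) (deg e v)%:R) / (n1%:R * (n%:R - n1%:R)) in
  lap_spread R e >= q - (min_deg e)%:R
  /\ (lap_spread R e = q - (min_deg e)%:R ->
      (exists s t : nat,
          [/\ forall v, v \in T -> deg_in e (~: T) v = s /\ deg e v = s,
              forall v, v \in ~: T -> deg_in e T v = t
            & (s * n1 = t * (n - n1))%N])
      /\ lap_eig R e 1 = q
      /\ alg_connectivity R e = (min_deg e)%:R).
Proof.
subst n n1.
have degT v : v \in T -> deg e v = deg_in e (~: T) v.
  move=> vT; apply: eq_card => w; rewrite !inE.
  have [wT|//] := boolP (w \in T); exact: negPf (T_indep v w vT wT).
rewrite (eq_bigr _ (fun v vT => congr1 (fun k => k%:R) (degT v vT))).
move=> q; have [x xT] := set0Pn _ T_neq0.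
have mu_ge : q <= lap_eig R e 1 := cut_le_lap_eig1 R e_sym T_neq0 T_neqV.
have a_le := alg_connectivity_le_min_deg R e_sym e_irr x e_ncomplete.
split; first exact: lerB.
move=> spreadE.
have muE : lap_eig R e 1 = q.
  apply/le_anti; rewrite mu_ge andbT -(lerD2r (- alg_connectivity R e)).
  by rewrite -/(lap_spread R e) spreadE lerD2l lerN2.
have aE : alg_connectivity R e = (min_deg e)%:R.
  by move: spreadE; rewrite /lap_spread muE => /addrI/oppr_inj.
split=> //.
(* After multiplication by n, the degrees to the other side are mu_1 * (n - n1)
   on T and mu_1 * n1 off T; all three conclusions follow by cancelling n. *)
have [regT regTC] := cut_eq_lap_eig1 e_sym T_neq0 T_neqV muE.
have [a0 b0 N0] := cut_gt0 R T_neq0 T_neqV.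
have NI := mulfI (lt0r_neq0 N0).
have /set0Pn[y yT] : ~: T != set0.
  by apply: contraNneq T_neqV => TC0; rewrite -[T]setCK TC0 setC0.
exists (deg_in e (~: T) x), (deg_in e T y); split.
- move=> v vT; rewrite degT //.
  suff -> : deg_in e (~: T) v = deg_in e (~: T) x by [].
  by apply/eqP; rewrite -(eqr_nat R); apply/eqP/NI; rewrite !regT.
- by move=> v vT; apply/eqP; rewrite -(eqr_nat R); apply/eqP/NI; rewrite !regTC.
apply/eqP; rewrite -(eqr_nat R) !natrM natrB ?max_card //; apply/eqP/NI.
by rewrite !mulrA regT // regTC // mulrAC.
Qed.
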